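(* Let $\mathcal{L}$ be a first-order language and let $\mathcal{M}$, $\mathcal{N}$ be $\mathcal{L}$-structures. If $\mathcal{N}$ is a substructure of $\mathcal{M}$ and $\theta \in \operatorname{Con}(\mathcal{M})$, then $$\frac{\mathcal{N}}{\theta|_N} \cong \frac{\mathcal{N}^\theta}{\theta|_{N^\theta}}.$$
   Context: The universe of an $\mathcal{L}$-structure $\mathcal{M}$ is denoted $M$; constants are $0$-ary function symbols. A strong homomorphism $f\colon \mathcal{M} \to \mathcal{N}$ of $\mathcal{L}$-structures is a map $M \to N$ such that $f(F^{\mathcal{M}}(x_1,\dots,x_n)) = F^{\mathcal{N}}(f(x_1),\dots,f(x_n))$ for every $n$-ary function symbol $F$, and $R^{\mathcal{M}}(x_1,\dots,x_n) \iff R^{\mathcal{N}}(f(x_1),\dots,f(x_n))$ for every $n$-ary relation symbol $R$, for all $x_1,\dots,x_n \in M$. Isomorphisms $\cong$ are bijective strong homomorphisms. A congruence on $\mathcal{M}$ is an equivalence relation $\theta$ on $M$ such that whenever $(x_i,y_i) \in \theta$ for $1 \le i \leq n$: $(F^{\mathcal{M}}(x_1,\dots,x_n), F^{\mathcal{M}}(y_1,\dots,y_n)) \in \theta$ for every $n$-ary function symbol $F$, and $R^{\mathcal{M}}(x_1,\dots,x_n) \iff R^{\mathcal{M}}(y_1,\dots,y_n)$ for every $n$-ary relation symbol $R$. $\operatorname{Con}(\mathcal{M})$ is the set of congruences on $\mathcal{M}$. For a congruence $\theta$ on $\mathcal{M}$, the quotient $\mathcal{M}/\theta$ is the $\mathcal{L}$-structure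 with universe $M/\theta = \{[x]_\theta \mid x \in M\}$, $F^{\mathcal{M}/\theta}([x_1]_\theta,\dots,[x_n]_\theta) = [F^{\mathcal{M}}(x_1,\dots,x_n)]_\theta$ and $R^{\mathcal{M}/\theta}([x_1]_\theta,\dots,[x_n]_\theta) \iff R^{\mathcal{M}}(x_1,\dots,x_n)$. For a substructure $\mathcal{N}$ of $\mathcal{M}$ and $\theta \in \operatorname{Con}(\mathcal{M})$, let $N^\theta = \{\, x \in M \mid N \cap [x]_\theta \neq \emptyset \,\}$, and let $\mathcal{N}^\theta$ be the smallest substructure of $\mathcal{M}$ containing the set $N^\theta$; its universe is exactly $N^\theta$. For the universe $N$ of a substructure of $\mathcal{M}$, $\theta|_N = \theta \cap N^2$, which is a congruence on that substructure (and likewise for $N^\theta$). *)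

(* Defs.v *)
From mathcomp Require Import all_boot.
From mathcomp Require Import boolp classical_sets.
From Stdlib Require Import RelationClasses.

Set Implicit Arguments.
Unset Strict Implicit.
Unset Printing Implicit Defensive.

Local Open Scope classical_set_scope.

(* Constants are the function symbols of arity 0. *)
Record language : Type := Language {
  fun_sym : Type;
  fun_arity : fun_sym -> nat;
  rel_sym : Type;
  rel_arity : rel_sym -> nat
}.

(* An n-tuple of elements is a function from 'I_n.  The universe is not
   required to be nonempty. *)
Record structure (L : language) : Type := Structure {
  universe :> Type;
  fun_interp : forall F : fun_sym L, ('I_(fun_arity F) -> universe) -> universe;
  rel_interp : forall R : rel_sym L, ('I_(rel_arity R) -> universe) -> Prop
}.

Definition strong_hom (L : language) (M N : structure L) (f : M -> N) : Prop :=
  (forall (F : fun_sym L) (x : 'I_(fun_arity F) -> M),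
      f (fun_interp x) = fun_interp (fun i => f (x i))) /\
  (forall (R : rel_sym L) (x : 'I_(rel_arity R) -> M),
      rel_interp x <-> rel_interp (fun i => f (x i))).

Definition isomorphic (L : language) (M N : structure L) : Prop :=
  exists f : M -> N, strong_hom f /\ bijective f.

Definition fun_closed (L : language) (M : structure L) (A : set M) : Prop :=
  forall (F : fun_sym L) (x : 'I_(fun_arity F) -> M),
    (forall i, A (x i)) -> A (fun_interp x).

(* A substructure is determined by its universe: its symbols are interpreted
   as the restrictions of those of M (see [substr_structure]). *)
Record substructure (L : language) (M : structure L) : Type := Substructure {
  substr_set :> set M;
  substr_closed : fun_closed substr_set
}.

Lemma substr_fun_mem (L : language) (M : structure L) (N : substructure M)
    (F : fun_sym L) (x : 'I_(fun_arity F) -> set_type N) :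
  fun_interp (fun i => val (x i)) \in (N : set M).
Proof. by apply/mem_set/substr_closed => i; exact/set_mem/valP. Qed.

Definition substr_structure (L : language) (M : structure L)
    (N : substructure M) : structure L :=
  @Structure L (set_type N)
    (fun F x => exist _ (fun_interp (fun i => val (x i))) (substr_fun_mem x))
    (fun R x => rel_interp (fun i => val (x i))).

Record congruence (L : language) (M : structure L) : Type := Congruence {
  cong_rel :> M -> M -> Prop;
  cong_equiv : Equivalence cong_rel;
  cong_fun : forall (F : fun_sym L) (x y : 'I_(fun_arity F) -> M),
      (forall i, cong_rel (x i) (y i)) ->
      cong_rel (fun_interp x) (fun_interp y);
  cong_rel_interp : forall (R : rel_sym L) (x y : 'I_(rel_arity R) -> M),
      (forall i, cong_rel (x i) (y i)) -> (rel_interp x <-> rel_interp y)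
}.

Definition eqclass (L : language) (M : structure L) (theta : congruence M)
    (x : M) : set M := [set y | theta x y].

Definition quot_universe (L : language) (M : structure L)
    (theta : congruence M) : Type := set_type (range (eqclass theta)).

Definition quot_pi (L : language) (M : structure L) (theta : congruence M)
    (x : M) : quot_universe theta :=
  exist _ (eqclass theta x) (mem_set (imageT (eqclass theta) x)).

Lemma quot_pi_surj (L : language) (M : structure L) (theta : congruence M)
    (c : quot_universe theta) : exists x, quot_pi theta x = c.
Proof.
have [x _ xc] := set_mem (valP c).
by exists x; apply: val_inj.
Qed.

Definition quot_repr (L : language) (M : structure L) (theta : congruence M)
    (c : quot_universe theta) : M := projT1 (cid (quot_pi_surj c)).

(* The interpretations are computed on chosen representatives; by
   [quot_funE] and [quot_relE] below the choice is immaterial. *)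
Definition quotient (L : language) (M : structure L) (theta : congruence M) :
    structure L :=
  @Structure L (quot_universe theta)
    (fun F c => quot_pi theta (fun_interp (fun i => quot_repr (c i))))
    (fun R c => rel_interp (fun i => quot_repr (c i))).

Lemma quot_piP (L : language) (M : structure L) (theta : congruence M)
    (x y : M) : quot_pi theta x = quot_pi theta y <-> theta x y.
Proof.
have [thetaR thetaS thetaT] := cong_equiv theta.
split=> [/(congr1 val) /= exy|xy].
  by have : eqclass theta y y := thetaR y; rewrite -exy.
apply: val_inj => /=; apply/seteqP; split=> z; rewrite /eqclass /= => h.
  exact: thetaT (thetaS _ _ xy) h.
exact: thetaT xy h.
Qed.

Lemma quot_reprK (L : language) (M : structure L) (theta : congruence M) :
  cancel (@quot_repr L M theta) (quot_pi theta).
Proof. by move=> c; exact: projT2 (cid (quot_pi_surj c)). Qed.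

Lemma quot_funE (L : language) (M : structure L) (theta : congruence M)
    (F : fun_sym L) (x : 'I_(fun_arity F) -> M) :
  @fun_interp L (quotient theta) F (fun i => quot_pi theta (x i)) =
  quot_pi theta (fun_interp x).
Proof.
by apply/quot_piP; apply: cong_fun => i; apply/quot_piP; rewrite quot_reprK.
Qed.

Lemma quot_relE (L : language) (M : structure L) (theta : congruence M)
    (R : rel_sym L) (x : 'I_(rel_arity R) -> M) :
  @rel_interp L (quotient theta) R (fun i => quot_pi theta (x i)) <->
  rel_interp x.
Proof.
apply: (@cong_rel_interp _ _ theta) => i.
by apply/quot_piP; rewrite quot_reprK.
Qed.

Lemma cong_restr_equiv (L : language) (M : structure L) (theta : congruence M)
    (N : substructure M) :
  Equivalence (fun x y : substr_structure N => theta (val x) (val y)).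
Proof.
have [thetaR thetaS thetaT] := cong_equiv theta.
by split=> [x|x y|x y z]; [exact: thetaR|exact: thetaS|exact: thetaT].
Qed.

Definition cong_restr (L : language) (M : structure L) (theta : congruence M)
    (N : substructure M) : congruence (substr_structure N) :=
  @Congruence L (substr_structure N) (fun x y => theta (val x) (val y))
    (cong_restr_equiv theta N)
    (fun F x y => @cong_fun L M theta F (fun i => val (x i)) (fun i => val (y i)))
    (fun R x y =>
       @cong_rel_interp L M theta R (fun i => val (x i)) (fun i => val (y i))).

Lemma smallest_fun_closed (L : language) (M : structure L) (A : set M) :
  fun_closed (smallest (@fun_closed L M) A).
Proof.
move=> F x xA B [Bcl AB]; apply: (Bcl) => i.
by apply: xA; split.
Qed.

Definition generated_substructure (L : language) (M : structure L)
    (A : set M) : substructure M :=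
  @Substructure L M (smallest (@fun_closed L M) A) (@smallest_fun_closed L M A).

Definition sat_set (L : language) (M : structure L) (theta : congruence M)
    (N : set M) : set M := [set x | N `&` eqclass theta x !=set0].

Definition saturation (L : language) (M : structure L) (theta : congruence M)
    (N : substructure M) : substructure M :=
  generated_substructure (sat_set theta N).

Lemma saturationE (L : language) (M : structure L) (theta : congruence M)
    (N : substructure M) : saturation theta N = sat_set theta N :> set M.
Proof.
apply/seteqP; split; last exact: sub_gen_smallest.
apply: smallest_sub => // F x xN.
have {xN} /choice[y xy] : forall i, exists z, (N : set M) z /\ theta (x i) z.
  by move=> i; have [z [Nz xz]] := xN i; exists z.
exists (fun_interp y); split; first by apply: substr_closed => i; case: (xy i).
by apply: cong_fun => i; case: (xy i).
Qed.

(* Main.v *)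
(* The inclusion of N into its saturation is a strong homomorphism which
   reflects theta and meets every theta-class of the saturation, so it induces
   a bijective strong homomorphism between the quotients. *)
From mathcomp Require Import all_boot.
From mathcomp Require Import boolp classical_sets.
Require Import Defs.

Set Implicit Arguments.
Unset Strict Implicit.
Unset Printing Implicit Defensive.

Local Open Scope classical_set_scope.

(** The forward half of the equivalence makes the map induced by [h] well defined, the backward half
    makes it injective. *)
Lemma quotient_isomorphic (L : language) (A B : structure L)
    (theta : congruence A) (phi : congruence B) (h : A -> B) :
  strong_hom h ->
  (forall x y, theta x y <-> phi (h x) (h y)) ->
  (forall b, exists a, phi b (h a)) ->
  isomorphic (quotient theta) (quotient phi).
Proof.
move=> [hF hR] hE /choice[s sP].
pose f (c : quotient theta) : quotient phi := quot_pi phi (h (quot_repr c)).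
pose g (d : quotient phi) : quotient theta := quot_pi theta (s (quot_repr d)).
have f_pi x : f (quot_pi theta x) = quot_pi phi (h x).
  by apply/quot_piP/hE/quot_piP; rewrite quot_reprK.
have fg : cancel g f.
  move=> d; rewrite f_pi -[RHS]quot_reprK.
  by apply/esym/quot_piP/sP.
have f_inj : injective f.
  by move=> c d /quot_piP/hE/quot_piP; rewrite !quot_reprK.
(* A right inverse of an injective map is two-sided: [f (g (f c)) = f c]. *)
exists f; split; last by exists g => // c; apply: f_inj; rewrite fg.
split=> [F c|R c].
  (* By definition, [F] applied to [c] is the [quot_pi] of its value on representatives, so [f_pi]
     applies. *)
  by rewrite [LHS]f_pi hF -quot_funE.
by rewrite [X in _ <-> X]quot_relE -hR.
Qed.

Lemma sub_saturation (L : language) (M : structure L) (N : substructure M)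
    (theta : congruence M) :
  (N : set M) `<=` saturation theta N.
Proof.
have [thetaR _ _] := cong_equiv theta.
by rewrite saturationE => x Nx; exists x; split=> //; exact: thetaR.
Qed.

Theorem theorem4p3 (L : language) (M : structure L) (N : substructure M)
    (theta : congruence M) :
  isomorphic (quotient (cong_restr theta N))
             (quotient (cong_restr theta (saturation theta N))).
Proof.
pose incl (x : substr_structure N) : substr_structure (saturation theta N) :=
  exist _ (val x) (mem_set (@sub_saturation _ _ _ theta _ (set_mem (valP x)))).
(* Both restricted congruences compare underlying elements of [M], so [incl] reflects them by
   computation. *)
apply: (@quotient_isomorphic _ _ _ _ _ incl) => //.
  by split=> // F x; exact: val_inj.
move=> b; have := set_mem (valP b).
(* As the saturation is exactly [sat_set theta N], the class of [b] contains some [a] in [N]. *)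
rewrite {1}saturationE => -[a [Na ba]].
by exists (exist _ a (mem_set Na)).
Qed.
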